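(* Let $n\ge 1$ and $\lambda\in(0,n)$. Then $\mathcal{E}_{\alpha,\lambda}$ Gamma-converges to $\mathcal{E}_{\infty,\lambda}$ on $\mathcal{P}$ as $\alpha\to\infty$, with respect to the weak topology of measures.
   Context: $\mathcal{P}$ is the set of Borel measures $\mu$ on $\mathbb{R}^n$ with $\mu(\mathbb{R}^n)=1$. For $\alpha\in(0,\infty)$ and $\mu\in\mathcal{P}$, $$\mathcal{E}_{\alpha,\lambda}(\mu)=\int_{\mathbb{R}^n}\int_{\mathbb{R}^n}\bigl(|x-y|^{\alpha}+|x-y|^{-\lambda}\bigr)\,d\mu(x)\,d\mu(y)\in(0,+\infty],$$ where $|x-y|^{-\lambda}=+\infty$ if $x=y$. The limiting functional is $$\mathcal{E}_{\infty,\lambda}(\mu)=\begin{cases}\displaystyle\int_{\mathbb{R}^n}\int_{\mathbb{R}^n}|x-y|^{-\lambda}\,d\mu(x)\,d\mu(y) & \text{if } \operatorname{diam}(\operatorname{supp}\mu)\le 1,\\ +\infty & \text{otherwise.}\end{cases}$$ Weak convergence $\mu_k\rightharpoonup\mu$ in $\mathcal{P}$ means $\int\phi\,d\mu_k\to\int\phi\,d\mu$ for every bounded continuous function $\phi$ on $\mathbb{R}^n$. A sequence of functions $G_k$ on a topological space $X$ Gamma-converges to $G$ if for every $x\in X$: (i) for all sequences $x_k\to x$ in $X$, $\liminf_{k\to\infty}G_k(x_k)\ge G(x)$; and (ii) there exists a sequence $x_k\to x$ in $X$ with $\limsup_{k\to\infty}G_k(x_k)\le G(x)$. Gamma-convergence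 as $\alpha\to\infty$ means that $\mathcal{E}_{\alpha_k,\lambda}$ Gamma-converges to $\mathcal{E}_{\infty,\lambda}$ for every sequence $\alpha_k\to\infty$ in $(0,\infty)$. *)

(* Defs.v *)
From HB Require Import structures.
From mathcomp Require Import all_boot all_order all_algebra.
From mathcomp Require Import all_classical all_reals all_analysis.

Set Implicit Arguments.
Unset Strict Implicit.
Unset Printing Implicit Defensive.

Import Order.TTheory GRing.Theory Num.Theory.
Import numFieldNormedType.Exports.

Local Open Scope classical_set_scope.
Local Open Scope ring_scope.

(* R^n is ['rV[R]_n]. The library norm on it is the sup norm, which induces the
   usual topology; the Euclidean distance is therefore defined separately. *)
Definition edist (R : realType) (n : nat) (x y : 'rV[R]_n) : R :=
  Num.sqrt (\sum_(i < n) (x ord0 i - y ord0 i) ^+ 2).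

Notation borelRn R n := (g_sigma_algebraType (@open 'rV[R]_n)).

Definition bcont (R : realType) (n : nat) : Type :=
  {phi : 'rV[R]_n -> R | continuous phi /\ bounded_fun phi}.

Definition integrals (R : realType) (n : nat) (mu : probability (borelRn R n) R)
    : {ptws bcont R n -> R} :=
  fun phi => \int[mu]_x sval phi x.
Arguments integrals {R n} mu.

(* The set of Borel probability measures on R^n, with the coarsest topology
   making [mu |-> \int[mu]_x phi x] continuous for each bounded continuous
   [phi]. *)
Definition Prob (R : realType) (n : nat) : Type :=
  initial_topology (@integrals R n).

Lemma weak_cvgP (R : realType) (n : nat) (mu_ : nat -> Prob R n)
    (mu : Prob R n) :
  mu_ @ \oo --> mu <->
  forall phi : 'rV[R]_n -> R, continuous phi -> bounded_fun phi ->
    (fun k => \int[mu_ k]_x phi x) @ \oo --> \int[mu]_x phi x.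
Proof.
split => [cv phi cphi bphi|cv].
  pose psi : bcont R n := exist _ phi (conj cphi bphi).
  have : integrals \o mu_ @ \oo --> (integrals mu : {ptws bcont R n -> R}).
    apply: cvg_trans (@initial_continuous _ _ (@integrals R n) mu).
    exact: (cvg_app _ cv).
  move=> /cvg_sup/(_ psi) h.
  apply: cvg_trans (@initial_continuous _ _
    (fun f : bcont R n -> R => f psi) (integrals mu)).
  exact: (cvg_app _ h).
have h : integrals \o mu_ @ \oo --> (integrals mu : {ptws bcont R n -> R}).
  suff H (psi : bcont R n) : integrals \o mu_ @ \oo -->
      (integrals mu : initial_topology (fun f : bcont R n -> R => f psi)).
    pose Tc psi :=
      Topological.class (initial_topology (fun f : bcont R n -> R => f psi)).
    by refine (proj2 (@cvg_sup _ _ Tc _ (integrals mu) _) H).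
  move=> A /= [_ [[B oB <-] Bmu sBA]].
  have /(cv _ (svalP psi).1 (svalP psi).2) : nbhs (integrals mu psi) B.
    exact: open_nbhs_nbhs.
  by move=> hB; apply: (@filterS _ \oo _ _ _ _ hB) => k; exact: sBA.
move=> A /= [_ [[B oB <-] Bmu sBA]].
have /h : nbhs (integrals mu : {ptws _ -> _}) B by exact: open_nbhs_nbhs.
by move=> hB; apply: (@filterS _ \oo _ _ _ _ hB) => k; exact: sBA.
Qed.

Definition gamma_cvg (R : realType) (X : topologicalType)
    (G_ : nat -> X -> \bar R) (G : X -> \bar R) : Prop :=
  forall x : X,
    (forall x_ : nat -> X, x_ @ \oo --> x ->
       (G x <= limn_einf (fun k => G_ k (x_ k)))%E) /\
    (exists2 x_ : nat -> X, x_ @ \oo --> x &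
       (limn_esup (fun k => G_ k (x_ k)) <= G x)%E).

(* The case split is needed since the library has [0 `^ (- lam) = 0] for
   [lam != 0]. *)
Definition rieszk (R : realType) (n : nat) (lam : R) (x y : 'rV[R]_n) : \bar R :=
  if x == y then +oo%E else (edist x y `^ (- lam))%:E.

Definition energy (R : realType) (n : nat) (alpha lam : R) (mu : Prob R n)
    : \bar R :=
  (\int[mu]_y \int[mu]_x ((edist x y `^ alpha)%:E + rieszk lam x y))%E.

Definition msupp (R : realType) (n : nat) (mu : Prob R n) : set 'rV[R]_n :=
  [set x | forall U : set 'rV[R]_n, open U -> U x -> (0 < mu U)%E].

Definition ediam (R : realType) (n : nat) (A : set 'rV[R]_n) : \bar R :=
  ereal_sup [set (edist x y)%:E | x in A & y in A].

Definition energy_lim (R : realType) (n : nat) (lam : R) (mu : Prob R n)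
    : \bar R :=
  if (ediam (msupp mu) <= 1)%E then (\int[mu]_y \int[mu]_x rieszk lam x y)%E
  else +oo%E.

(* Main.v *)
(* Lower bound.  If F is bounded, nonnegative and Lipschitz, the double integral
   of F(|x - y|) is weakly lower semicontinuous in mu; apply this to truncations
   of r^(-lambda), which increase to the Riesz kernel.  When the support has
   diameter > 1, use A (1 - 1/max(r,1)) instead, which is below r^alpha once
   alpha >= A and has a double integral proportional to A.
   Upper bound.  When the support has diameter at most 1, the constant sequence
   is not good enough, because mu x mu may charge |x - y| = 1.  Dilating mu by
   s_k = exp(-alpha_k^(-1/2)) makes the attractive part at most
   s_k^alpha_k = exp(-alpha_k^(1/2)), while the Riesz energy is only multiplied
   by s_k^(-lambda), which tends to 1. *)
From HB Require Import structures.
Require Import Defs.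
From mathcomp Require Import all_boot all_order all_algebra.
From mathcomp Require Import all_classical all_reals all_analysis.
From mathcomp Require Import measurable_realfun ring lra.

Import Order.TTheory GRing.Theory Num.Theory.
Import numFieldNormedType.Exports.

Local Open Scope classical_set_scope.
Local Open Scope ring_scope.

(* [all_analysis] shadows [Defs.edist] with its extended distance. *)
Local Notation edist := Defs.edist.

(** * The Euclidean distance and its relation to the topology of the sup norm *)

Section EuclideanDistance.
Context {R : realType} {n : nat}.
Implicit Types x y z : 'rV[R]_n.

Lemma edist_ge0 x y : 0 <= edist x y.
Proof. exact: sqrtr_ge0. Qed.

Lemma edistC x y : edist x y = edist y x.
Proof.
by congr Num.sqrt; apply: eq_bigr => i _; rewrite -sqrrN opprB.
Qed.

Lemma edistxx x : edist x x = 0.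
Proof.
by rewrite /edist big1 ?sqrtr0// => i _; rewrite subrr expr0n.
Qed.

Lemma edist_eq0 x y : (edist x y == 0) = (x == y).
Proof.
apply/idP/eqP => [|->]; last by rewrite edistxx.
rewrite sqrtr_eq0 => h.
have /eqP : \sum_(i < n) (x ord0 i - y ord0 i) ^+ 2 = 0.
  by apply/eqP; rewrite eq_le h sumr_ge0// => i _; exact: sqr_ge0.
rewrite psumr_eq0; last by move=> i _; exact: sqr_ge0.
move=> /allP xy; apply/rowP => i; apply/eqP; rewrite -subr_eq0 -sqrf_eq0.
by apply: xy; rewrite mem_index_enum.
Qed.

Lemma edist_scale (s : R) x y :
  0 <= s -> edist (s *: x) (s *: y) = s * edist x y.
Proof.
move=> s0; rewrite /edist -[X in _ = X * _](ger0_norm s0) -sqrtr_sqr -sqrtrM ?sqr_ge0//.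
congr Num.sqrt; rewrite mulr_sumr; apply: eq_bigr => i _.
by rewrite !mxE -mulrBr exprMn.
Qed.

(** Squaring both sides reduces the claim to Cauchy-Schwarz, proved inside as [CS]. *)
Lemma minkowski_sqrt (a b : 'I_n -> R) :
  Num.sqrt (\sum_i (a i + b i) ^+ 2) <=
  Num.sqrt (\sum_i a i ^+ 2) + Num.sqrt (\sum_i b i ^+ 2).
Proof.
set A := Num.sqrt (\sum_i a i ^+ 2); set B := Num.sqrt (\sum_i b i ^+ 2).
have s0 (c : 'I_n -> R) : 0 <= \sum_i c i ^+ 2.
  by apply: sumr_ge0 => i _; exact: sqr_ge0.
have A0 : 0 <= A by exact: sqrtr_ge0.
have B0 : 0 <= B by exact: sqrtr_ge0.
have AE : \sum_i a i ^+ 2 = A ^+ 2 by rewrite sqr_sqrtr.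
have BE : \sum_i b i ^+ 2 = B ^+ 2 by rewrite sqr_sqrtr.
have CS : \sum_i a i * b i <= A * B.
  (* Expanded, this sum equals 2 A B (A B - sum of a_i b_i), which gives Cauchy-Schwarz when A B >
     0. If A B = 0, one of the two families vanishes identically. *)
  have : 0 <= \sum_i (B * a i - A * b i) ^+ 2 by exact: s0.
  have -> : \sum_i (B * a i - A * b i) ^+ 2 =
      B ^+ 2 * (\sum_i a i ^+ 2) - 2 * (A * B) * (\sum_i a i * b i) +
      A ^+ 2 * (\sum_i b i ^+ 2).
    rewrite !mulr_sumr -sumrN -!big_split/=; apply: eq_bigr => i _.
    by ring.
  rewrite AE BE => h.
  have := mulr_ge0 A0 B0; rewrite le_eqVlt => /predU1P[AB0|AB0]; last by nra.
  suff -> : \sum_i a i * b i = 0 by rewrite -AB0.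
  apply: big1 => i _; move/esym/eqP: AB0; rewrite mulf_eq0.
  move=> /orP[]/eqP c0.
  - move: AE => /eqP; rewrite c0 expr0n/= psumr_eq0; last by move=> j _; exact: sqr_ge0.
    by move=> /allP/(_ i (mem_index_enum _)); rewrite sqrf_eq0 => /eqP ->; rewrite mul0r.
  - move: BE => /eqP; rewrite c0 expr0n/= psumr_eq0; last by move=> j _; exact: sqr_ge0.
    by move=> /allP/(_ i (mem_index_enum _)); rewrite sqrf_eq0 => /eqP ->; rewrite mulr0.
rewrite -[leRHS]ger0_norm ?addr_ge0// -sqrtr_sqr ler_wsqrtr//.
have -> : \sum_i (a i + b i) ^+ 2 =
    \sum_i a i ^+ 2 + 2 * (\sum_i a i * b i) + \sum_i b i ^+ 2.
  by rewrite mulr_sumr -!big_split/=; apply: eq_bigr => i _; ring.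
by rewrite AE BE; nra.
Qed.

Lemma edist_triangle y x z : edist x z <= edist x y + edist y z.
Proof.
apply: le_trans (minkowski_sqrt _ _); rewrite le_eqVlt; apply/orP; left.
by apply/eqP; congr Num.sqrt; apply: eq_bigr => i _; rewrite subrKA.
Qed.

Lemma edist_lip x y z : `|edist x y - edist x z| <= edist y z.
Proof.
have := edist_triangle z x y; have := edist_triangle y x z.
by rewrite (edistC z y) ler_norml => *; apply/andP; split; lra.
Qed.

(** This links [edist] to the ambient topology: the squared distance is a polynomial in the
    coordinates, which are continuous. Through it, Lipschitz bounds in [edist] yield continuity. *)
Lemma edistr_cvg0 y : edist y z @[z --> y] --> 0.
Proof.
have sc : continuous (fun z : 'rV[R]_n => \sum_(i < n) (y ord0 i - z ord0 i) ^+ 2).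
  apply: continuous_big => [|i _ z]; first exact: add_continuous.
  have h : y ord0 i - w ord0 i @[w --> z] --> y ord0 i - z ord0 i.
    by apply: cvgB; [exact: cvg_cst|exact: coord_continuous].
  exact: (cvgM h h).
rewrite -(edistxx y).
exact: continuous_comp (sc y) (@sqrt_continuous R _).
Qed.

Lemma edist_lip_continuous (f : 'rV[R]_n -> R) (L : R) :
  (forall x y, `|f x - f y| <= L * edist x y) -> continuous f.
Proof.
move=> fL y.
have h : L * edist y z @[z --> y] --> 0.
  by rewrite -(mulr0 L); exact: (@cvgMl_tmp _ _ _ (nbhs_filter y) _ _ _ (edistr_cvg0 y)).
apply/(@cvgrPdist_le _ _ _ _ (nbhs_filter y)) => e e0; near=> z.
rewrite (le_trans (fL _ _))// (le_trans (ler_norm _))//.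
near: z; exact: (@cvgr0_norm_le _ _ _ _ (nbhs_filter y) _ h e e0).
Unshelve. all: by end_near. Qed.

Lemma continuous_borel_measurable (f : 'rV[R]_n -> R) :
  continuous f -> measurable_fun setT (f : borelRn R n -> R).
Proof.
move=> /continuousP cf.
apply: (measurability _ (RGenOpens.measurableE R)).
move=> _ [_ [a [b ->] <-]]; rewrite setTI; apply: sub_gen_smallest.
by apply: cf; exact: interval_open.
Qed.

End EuclideanDistance.

(** * Negative powers, cut off near the origin *)

Section TruncatedPower.
Context {R : realType}.
Implicit Types a p r s x y : R.

Lemma powRN_anti p x y : 0 <= p -> 0 < x -> x <= y -> y `^ (- p) <= x `^ (- p).
Proof.
move=> p0 x0 xy; have y0 : 0 < y by exact: lt_le_trans xy.
rewrite /powR !gt_eqF// ler_expR !mulNr lerN2 ler_wpM2l//.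
by rewrite ler_ln ?posrE.
Qed.

(** Two tangent-line inequalities replace the mean value theorem: ln (1 + t) <= t bounds ln y - ln x
    by (y - x) / a, and exp t >= 1 + t bounds y^(-p) below by x^(-p) (1 - p (ln y - ln x)). *)
Lemma powRN_lip a p x y : 0 <= p -> 0 < a -> a <= x -> x <= y ->
  x `^ (- p) - y `^ (- p) <= a `^ (- p) * p / a * (y - x).
Proof.
move=> p0 a0 ax xy; have x0 : 0 < x by exact: lt_le_trans ax.
have y0 : 0 < y by exact: lt_le_trans xy.
have lnxy : ln y - ln x <= (y - x) / a.
  rewrite -ln_div ?posrE//.
  have -> : y / x = 1 + (y - x) / x by field; rewrite gt_eqF.
  apply: le_trans (le_ln1Dx _) _.
    by rewrite (lt_le_trans (ltrN10 _))// divr_ge0 ?subr_ge0// ltW.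
  by rewrite ler_wpM2l ?subr_ge0// lef_pV2 ?posrE.
have ye : x `^ (- p) * (1 - p * (ln y - ln x)) <= y `^ (- p).
  rewrite {2}/powR (gt_eqF y0).
  have -> : - p * ln y = - p * ln x + - (p * (ln y - ln x)) by ring.
  rewrite expRD [X in X * _]/powR (gt_eqF x0) ler_wpM2l ?expR_ge0//.
  exact: expR_ge1Dx.
have xap := powRN_anti _ _ _ p0 a0 ax.
have xp0 := powR_ge0 x (- p).
apply: (@le_trans _ _ (x `^ (- p) * (p * ((y - x) / a)))).
  have : x `^ (- p) * (p * (ln y - ln x)) <= x `^ (- p) * (p * ((y - x) / a)).
    by rewrite !ler_wpM2l.
  by lra.
have -> : a `^ (- p) * p / a * (y - x) = a `^ (- p) * (p * ((y - x) / a)) by ring.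
rewrite ler_wpM2r// mulr_ge0// divr_ge0 ?subr_ge0//; exact: ltW.
Qed.

(** Freezing the argument at [a] makes the power bounded and Lipschitz on the whole line, including
    r <= 0. *)
Definition trunc_pow a p r : R := Num.max r a `^ (- p).

Lemma trunc_pow_ge0 a p r : 0 <= trunc_pow a p r.
Proof. exact: powR_ge0. Qed.

Lemma trunc_pow_le a p r : 0 <= p -> 0 < a -> trunc_pow a p r <= a `^ (- p).
Proof. by move=> p0 a0; apply: powRN_anti => //; rewrite le_max lexx orbT. Qed.

Lemma trunc_pow_lip a p r s : 0 <= p -> 0 < a ->
  `|trunc_pow a p r - trunc_pow a p s| <= a `^ (- p) * p / a * `|r - s|.
Proof.
move=> p0 a0; wlog rs : r s / r <= s.
  by move=> h; case/orP : (le_total r s) => /h//; rewrite distrC (distrC r).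
have rs' : Num.max r a <= Num.max s a by rewrite ge_max !le_max rs lexx orbT.
have ar : a <= Num.max r a by rewrite le_max lexx orbT.
have h := powRN_lip _ _ _ _ p0 a0 ar rs'.
rewrite ger0_norm; last first.
  by rewrite subr_ge0; apply: powRN_anti => //; exact: lt_le_trans ar.
apply: (le_trans h).
rewrite ler_wpM2l//; first by rewrite divr_ge0 ?mulr_ge0 ?powR_ge0// ltW.
rewrite distrC ger0_norm ?subr_ge0//.
by rewrite /Num.max; case: ifPn; case: ifPn; rewrite -?leNgt => *; lra.
Qed.

End TruncatedPower.

(** * Comparison of integrals, and auxiliary facts on bounds and lower limits *)

Section IntegralComparison.
Context {d : measure_display} {T : measurableType d} {R : realType}.
Variable mu : {measure set T -> \bar R}.
Local Open Scope ereal_scope.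

(** The integral of a nonnegative function is a supremum over the simple functions below it, and
    this family grows with the function. This form applies to the inner integrals of the energy,
    whose measurability in the outer variable is never established. *)
Lemma le_integral_nonmeasurable (f g : T -> \bar R) :
  (forall x, 0 <= f x) -> (forall x, f x <= g x) ->
  \int[mu]_x f x <= \int[mu]_x g x.
Proof.
move=> f0 fg; rewrite !ge0_integralTE//; last first.
  by move=> x; exact: le_trans (fg x).
apply: ereal_sup_le => _ [h hf <-]; exists h => //.
by move=> x; exact: le_trans (fg x).
Qed.

(** Adding to [g] a function that is infinite on [N] and zero elsewhere leaves its integral
    unchanged and makes it dominate [f] everywhere. *)
Lemma le_integral_off_null (N : set T) (f g : T -> \bar R) :
  measurable N -> mu N = 0 -> measurable_fun setT g ->
  (forall x, 0 <= f x) -> (forall x, 0 <= g x) ->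
  (forall x, ~ N x -> f x <= g x) ->
  \int[mu]_x f x <= \int[mu]_x g x.
Proof.
move=> mN N0 mg f0 g0 fg.
pose h := (cst +oo : T -> \bar R) \_ N.
have h0 x : 0 <= h x by apply: erestrict_ge0 => y _; exact: le0y.
have mh : measurable_fun setT h.
  by apply/(measurable_restrictT _ _).1 => //; exact: measurable_cst.
have <- : \int[mu]_x (g x + h x) = \int[mu]_x g x.
  by rewrite ge0_integralD// -integral_mkcond integral_cst// N0 mule0 adde0.
apply: le_integral_nonmeasurable => // x.
rewrite /h patchE; case: ifPn => [_|/negP xN].
  by rewrite /= addey ?leey// gt_eqF// (lt_le_trans _ (g0 x)).
by rewrite adde0; apply: fg => Nx; apply: xN; rewrite inE.
Qed.

End IntegralComparison.

Lemma bounded_fun_norm {R : realType} {T : Type} (f : T -> R) (B : R) :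
  (forall x, `|f x| <= B) -> bounded_fun f.
Proof.
move=> fB; exists B; split; first exact: num_real.
by move=> M BM x _; apply: (le_trans (fB x)); exact: ltW.
Qed.

Lemma limn_einf_ge {R : realType} (a b : (\bar R)^nat) (l : \bar R) :
  b @ \oo --> l -> (\forall k \near \oo, (b k <= a k)%E) ->
  (l <= limn_einf a)%E.
Proof.
move=> bl [m _ ba]; have bl' := cvg_einfs bl.
rewrite limn_einf_lim -(cvg_lim _ bl')//; apply: lee_lim.
- by apply/cvg_ex; exists l.
- exact: is_cvg_einfs.
near=> p; apply: le_ereal_inf_tmp => _ [k /= pk <-].
apply: le_trans (ba k _).
  by apply: ereal_inf_lbound; exists k.
by rewrite /= (leq_trans _ pk)//; near: p; exists m.
Unshelve. all: by end_near. Qed.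

Lemma integral_cst_Prob {R : realType} {n : nat} (mu : Prob R n) (c : \bar R) :
  (\int[mu]_x c)%E = c.
Proof.
rewrite -[X in integral _ _ X]/(cst c) integral_cst//.
by rewrite [X in (_ * X)%E](probability_setT (mu : probability (borelRn R n) R)) mule1.
Qed.

(** * Potentials of bounded Lipschitz kernels and weak lower semicontinuity *)

Section Potential.
Context {R : realType} {n : nat}.
Variables (F : R -> R) (B L : R).
Hypothesis F0 : forall r, 0 <= F r.
Hypothesis FB : forall r, F r <= B.
Hypothesis FL : forall r s, `|F r - F s| <= L * `|r - s|.
Implicit Types (mu : Prob R n) (x y z : 'rV[R]_n).

Let L0 : 0 <= L.
Proof. by have := FL 1 0; rewrite subr0 normr1 mulr1; exact: le_trans. Qed.

Let F_lip x y z : `|F (edist x y) - F (edist x z)| <= L * edist y z.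
Proof. by apply: (le_trans (FL _ _)); rewrite ler_wpM2l// edist_lip. Qed.

Lemma kernel_continuous y : continuous (fun x => F (edist x y)).
Proof.
apply: (edist_lip_continuous _ L) => x z.
by rewrite !(edistC _ y); exact: F_lip.
Qed.

Lemma kernel_bounded y : bounded_fun (fun x => F (edist x y)).
Proof. by apply: (bounded_fun_norm _ B) => x; rewrite ger0_norm. Qed.

Lemma continuous_bounded_integrable mu (f : 'rV[R]_n -> R) :
  continuous f -> bounded_fun f -> mu.-integrable setT (EFin \o f).
Proof.
move=> cf bf; apply: measurable_bounded_integrable => //.
- by rewrite [X in (X < _)%E](probability_setT (mu : probability (borelRn R n) R)) ltry.
- exact: continuous_borel_measurable.
Qed.

Let iF mu y : mu.-integrable setT (EFin \o (fun x => F (edist x y))).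
Proof.
by apply: continuous_bounded_integrable; [exact: kernel_continuous|exact: kernel_bounded].
Qed.

Definition pot mu y : R := \int[mu]_x F (edist x y).

Lemma potE mu y : (\int[mu]_x (F (edist x y))%:E)%E = (pot mu y)%:E.
Proof. by rewrite /pot /Rintegral fineK//; exact: integrable_fin_num (iF mu y). Qed.

Lemma pot_ge0 mu y : 0 <= pot mu y.
Proof. by apply: Rintegral_ge0. Qed.

Lemma pot_le mu y : pot mu y <= B.
Proof.
rewrite -lee_fin -potE.
rewrite -[leRHS](integral_cst_Prob mu).
by apply: le_integral_nonmeasurable => x; rewrite lee_fin.
Qed.

(** Since [mu] has mass 1, integrating the Lipschitz bound of the kernel keeps the constant [L]. It
    is the same for all [mu], which makes the potentials along a sequence equi-Lipschitz. *)
Lemma pot_lip mu y z : `|pot mu y - pot mu z| <= L * edist y z.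
Proof.
have lip u v : pot mu u <= pot mu v + L * edist u v.
  rewrite -lee_fin EFinD -!potE.
  rewrite -[(L * edist u v)%:E](integral_cst_Prob mu).
  rewrite -ge0_integralD//.
  - apply: le_integral_nonmeasurable => x; first by rewrite lee_fin.
    rewrite /= -EFinD lee_fin -lerBlDl.
    by rewrite (le_trans (ler_norm _))// F_lip.
  - by move=> x _; rewrite lee_fin.
  - apply/measurable_EFinP; apply: continuous_borel_measurable.
    exact: kernel_continuous.
  - by move=> x _; rewrite lee_fin mulr_ge0// edist_ge0.
have := lip y z; have := lip z y; rewrite (edistC z) ler_norml => *.
by apply/andP; split; lra.
Qed.

Lemma pot_continuous mu : continuous (pot mu).
Proof. by apply: (edist_lip_continuous _ L); exact: pot_lip. Qed.

Lemma pot_cvg (mu_ : nat -> Prob R n) mu y : mu_ @ \oo --> mu ->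
  pot (mu_ k) y @[k --> \oo] --> pot mu y.
Proof.
move=> /weak_cvgP; apply; [exact: kernel_continuous|exact: kernel_bounded].
Qed.

(* The lower envelopes [inf_{k >= m} pot (mu_ k)] are Lipschitz uniformly in
   [m], hence admissible test functions for the weak convergence, and increase
   to [pot mu]; no tightness is needed. *)
Lemma double_integral_liminf (mu_ : nat -> Prob R n) mu : mu_ @ \oo --> mu ->
  (\int[mu]_y (pot mu y)%:E <=
   limn_einf (fun k => \int[mu_ k]_y (pot (mu_ k) y)%:E))%E.
Proof.
move=> cmu.
pose h m y := infs (fun k => pot (mu_ k) y) m.
have hlb y : lbound (range (fun k => pot (mu_ k) y)) 0.
  by move=> _ [k _ <-]; exact: pot_ge0.
have hle m k y : (m <= k)%N -> h m y <= pot (mu_ k) y.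
  move=> mk; apply: ge_inf; last by exists k.
  by exists 0 => _ [j _ <-]; exact: pot_ge0.
have leh m y (c : R) : (forall k, (m <= k)%N -> c <= pot (mu_ k) y) -> c <= h m y.
  move=> cm; apply: lb_le_inf; first by exists (pot (mu_ m) y); exists m => /=.
  by move=> _ [k /= mk <-]; exact: cm.
have h0 m y : 0 <= h m y by apply: leh => k _; exact: pot_ge0.
have hB m y : h m y <= B by apply: (le_trans (hle _ _ _ (leqnn m))); exact: pot_le.
have hlip m y z : `|h m y - h m z| <= L * edist y z.
  (* An infimum of functions with a common Lipschitz constant keeps that constant. *)
  have lip u v : h m u - L * edist u v <= h m v.
    apply: leh => k mk; have := pot_lip (mu_ k) u v; rewrite ler_norml => /andP[_].
    by have := hle _ _ u mk; lra.
  have := lip y z; have := lip z y; rewrite (edistC z) ler_norml => *.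
  by apply/andP; split; lra.
have hc m : continuous (h m) by apply: (edist_lip_continuous _ L); exact: hlip.
have hb m : bounded_fun (h m) by apply: (bounded_fun_norm _ B) => x; rewrite ger0_norm.
have intE (nu : Prob R n) m : ((\int[nu]_y h m y)%:E = \int[nu]_y (h m y)%:E)%E.
  rewrite fineK//; apply: integrable_fin_num => //.
  exact: continuous_bounded_integrable.
(* For fixed [m], [h m] is a single test function lying below [pot (mu_ k)] for every k >= m; weak
   convergence is applied to it, and only afterwards does [m] tend to infinity. *)
have step m : (\int[mu]_y (h m y)%:E <=
   limn_einf (fun k => \int[mu_ k]_y (pot (mu_ k) y)%:E))%E.
  apply: (@limn_einf_ge _ _ (fun k => \int[mu_ k]_y (h m y)%:E)%E).
    have /weak_cvgP/(_ (h m) (hc m) (hb m)) H := cmu.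
    rewrite -intE; under eq_fun do rewrite -intE.
    by apply: cvg_EFin => //; exact: nearW.
  exists m => // k /= mk; apply: le_integral_nonmeasurable => y; rewrite lee_fin//.
  exact: hle.
have hcvg y : (h m y)%:E @[m --> \oo] --> (pot mu y)%:E.
  apply: cvg_EFin; first exact: nearW.
  by apply: cvg_infs; exact: pot_cvg.
have -> : (\int[mu]_y (pot mu y)%:E = \int[mu]_y limn (fun m => (h m y)%:E))%E.
  by apply: eq_integral => y _; apply/esym/cvg_lim => //; exact: hcvg.
have mono : (\int[mu]_y (h m y)%:E)%E @[m --> \oo] -->
    (\int[mu]_y limn (fun m => (h m y)%:E))%E.
  apply: cvg_monotone_convergence => //.
  - by move=> m; apply/measurable_EFinP; exact: continuous_borel_measurable.
  - by move=> m y _; rewrite lee_fin.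
  - move=> y _ m p mp; rewrite lee_fin; apply: leh => k pk; apply: hle.
    exact: leq_trans pk.
rewrite -(cvg_lim _ mono)//; apply: lime_le; first by apply/cvg_ex; eexists; exact: mono.
exact: nearW.
Qed.

End Potential.

Lemma le_limn_einf {R : realType} (a b : (\bar R)^nat) :
  (\forall k \near \oo, (a k <= b k)%E) -> (limn_einf a <= limn_einf b)%E.
Proof.
move=> [m _ ab]; rewrite !limn_einf_lim; apply: lee_lim; [exact: is_cvg_einfs..|].
near=> p; apply: le_ereal_inf_tmp => _ [k /= pk <-].
apply: le_trans (ab k _); first by apply: ereal_inf_lbound; exists k.
by rewrite /= (leq_trans _ pk)//; near: p; exists m.
Unshelve. all: by end_near. Qed.

(** * The Riesz kernel as an increasing limit of truncations, and the first lower bound *)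

Section RieszPotential.
Context {R : realType} {n : nat}.
Variable lam : R.
Hypothesis lam0 : 0 < lam.
Implicit Types (mu : Prob R n) (x y z : 'rV[R]_n).

(** The cutoff radius is 1 / (m + 1), so that it is defined and positive already at m = 0. *)
Definition riesz_trunc (m : nat) : R -> R := trunc_pow m.+1%:R^-1 lam.
Definition riesz_bound (m : nat) : R := m.+1%:R^-1 `^ (- lam).
Definition riesz_lip (m : nat) : R := riesz_bound m * lam / m.+1%:R^-1.

Let inv0 m : 0 < m.+1%:R^-1 :> R. Proof. by rewrite invr_gt0 ltr0n. Qed.
Let lam0' : 0 <= lam. Proof. exact: ltW. Qed.

Lemma riesz_trunc_ge0 m r : 0 <= riesz_trunc m r.
Proof. exact: trunc_pow_ge0. Qed.

Lemma riesz_trunc_le m r : riesz_trunc m r <= riesz_bound m.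
Proof. exact: trunc_pow_le. Qed.

Lemma riesz_trunc_lip m r s :
  `|riesz_trunc m r - riesz_trunc m s| <= riesz_lip m * `|r - s|.
Proof. exact: trunc_pow_lip. Qed.

Lemma riesz_trunc_nd r : nondecreasing_seq (riesz_trunc ^~ r).
Proof.
move=> m p mp; apply: powRN_anti => //.
  by rewrite lt_max inv0 orbT.
by rewrite ge_max !le_max lexx/= lef_pV2 ?posrE// ler_nat ltnS mp orbT.
Qed.

Lemma rieszk_ge0 x y : (0 <= rieszk lam x y)%E.
Proof. by rewrite /rieszk; case: ifP => _; rewrite ?le0y// lee_fin powR_ge0. Qed.

Lemma riesz_trunc_rieszk m x y :
  ((riesz_trunc m (edist x y))%:E <= rieszk lam x y)%E.
Proof.
rewrite /rieszk; case: ifPn => [_|xy]; first exact: leey.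
rewrite lee_fin powRN_anti//; last by rewrite le_max lexx.
by rewrite lt_neqAle edist_ge0 eq_sym edist_eq0 xy.
Qed.

(** On the diagonal the truncations equal (m + 1)^lam and diverge because lam > 0. Off it they are
    constant as soon as the cutoff radius is below the distance. *)
Lemma riesz_trunc_cvg x y :
  (riesz_trunc m (edist x y))%:E @[m --> \oo] --> rieszk lam x y.
Proof.
rewrite /rieszk; case: ifPn => [/eqP ->|xy].
  apply/cvgeyPge => A; near=> m.
  rewrite lee_fin /riesz_trunc /trunc_pow edistxx (max_r (ltW (inv0 _))).
  rewrite -powR_inv1// -powRrM mulrNN mul1r (le_trans (ler_norm A))//.
  (* Written as a power [lam], the bound holds for all m >= |A|^(1 / lam). *)
  have -> : `|A| = (`|A| `^ lam^-1) `^ lam.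
    by rewrite -powRrM mulVf ?powRr1// gt_eqF.
  apply: ge0_ler_powR; rewrite ?nnegrE ?powR_ge0//.
  apply: (@le_trans _ _ m%:R); last by rewrite ler_nat.
  by near: m; exact: nbhs_infty_ger.
apply: cvg_EFin; first exact: nearW.
have r0 : 0 < edist x y by rewrite lt_neqAle edist_ge0 eq_sym edist_eq0 xy.
apply: cvg_near_cst; near=> m.
rewrite /= /riesz_trunc /trunc_pow max_l// ltW//.
by near: m; exact: (near_infty_natSinv_lt (PosNum r0)).
Unshelve. all: by end_near. Qed.

Lemma rieszk_measurable y :
  measurable_fun setT ((fun x => rieszk lam x y) : borelRn R n -> \bar R).
Proof.
apply: (emeasurable_fun_cvg (fun m (x : borelRn R n) => (riesz_trunc m (edist x y))%:E)).
  move=> m; apply/measurable_EFinP; apply: continuous_borel_measurable.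
  exact: kernel_continuous (riesz_trunc_lip m) y.
by move=> x _; exact: riesz_trunc_cvg.
Qed.

Lemma riesz_pot_cvg mu y :
  (pot (riesz_trunc m) mu y)%:E @[m --> \oo] --> (\int[mu]_x rieszk lam x y)%E.
Proof.
under eq_fun => m do rewrite -(potE _ _ _ (riesz_trunc_ge0 m)
  (riesz_trunc_le m) (riesz_trunc_lip m)).
have -> : (\int[mu]_x rieszk lam x y =
    \int[mu]_x limn (fun m => (riesz_trunc m (edist x y))%:E))%E.
  by apply: eq_integral => x _; apply/esym/cvg_lim => //; exact: riesz_trunc_cvg.
apply: cvg_monotone_convergence => //.
- move=> m; apply/measurable_EFinP; apply: continuous_borel_measurable.
  exact: kernel_continuous (riesz_trunc_lip m) y.
- by move=> m x _; rewrite lee_fin riesz_trunc_ge0.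
- by move=> x _ m p mp; rewrite lee_fin riesz_trunc_nd.
Qed.

Lemma riesz_potential_measurable mu :
  measurable_fun setT
    ((fun y => (\int[mu]_x rieszk lam x y)%E) : borelRn R n -> \bar R).
Proof.
apply: (emeasurable_fun_cvg (fun m (y : borelRn R n) => (pot (riesz_trunc m) mu y)%:E)).
  move=> m; apply/measurable_EFinP; apply: continuous_borel_measurable.
  exact: pot_continuous (riesz_trunc_ge0 m) (riesz_trunc_le m) (riesz_trunc_lip m) mu.
by move=> x _; exact: riesz_pot_cvg.
Qed.

(** Monotone convergence in the outer variable, after [riesz_pot_cvg] has used it in the inner one;
    the potentials increase with [m] because the truncated kernels do. *)
Lemma riesz_energy_cvg mu :
  (\int[mu]_y (pot (riesz_trunc m) mu y)%:E)%E @[m --> \oo] -->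
  (\int[mu]_y \int[mu]_x rieszk lam x y)%E.
Proof.
have -> : (\int[mu]_y \int[mu]_x rieszk lam x y =
    \int[mu]_y limn (fun m => (pot (riesz_trunc m) mu y)%:E))%E.
  by apply: eq_integral => x _; apply/esym/cvg_lim => //; exact: riesz_pot_cvg.
apply: cvg_monotone_convergence => //.
- move=> m; apply/measurable_EFinP; apply: continuous_borel_measurable.
  exact: pot_continuous (riesz_trunc_ge0 m) (riesz_trunc_le m) (riesz_trunc_lip m) mu.
- by move=> m x _; rewrite lee_fin pot_ge0//; exact: riesz_trunc_ge0.
- move=> y _ m p mp.
  rewrite -!(potE _ _ _ (riesz_trunc_ge0 _) (riesz_trunc_le _) (riesz_trunc_lip _)).
  by apply: le_integral_nonmeasurable => x; rewrite lee_fin ?riesz_trunc_ge0 ?riesz_trunc_nd.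
Qed.

Lemma energy_ge_double_integral (F : R -> R) (B L alpha : R) mu :
  (forall r, 0 <= F r) -> (forall r, F r <= B) ->
  (forall r s, `|F r - F s| <= L * `|r - s|) ->
  (forall x y, ((F (edist x y))%:E <=
    (edist x y `^ alpha)%:E + rieszk lam x y)%E) ->
  (\int[mu]_y (pot F mu y)%:E <= energy alpha lam mu)%E.
Proof.
move=> F0 FB FL FK; apply: le_integral_nonmeasurable => y.
  by rewrite lee_fin pot_ge0.
rewrite -(potE _ _ _ F0 FB FL); apply: le_integral_nonmeasurable => x.
  by rewrite lee_fin.
exact: FK.
Qed.

(** The nonnegative attractive term is dropped. Each truncation bounds the lower limit of the
    energies from below, and the truncation level is sent to infinity last. *)
Lemma riesz_liminf (alpha_ : nat -> R) (mu_ : nat -> Prob R n) mu :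
  mu_ @ \oo --> mu ->
  (\int[mu]_y \int[mu]_x rieszk lam x y <=
   limn_einf (fun k => energy (alpha_ k) lam (mu_ k)))%E.
Proof.
move=> cmu; have rc := riesz_energy_cvg mu.
rewrite -(cvg_lim _ rc)//; apply: lime_le; first by apply/cvg_ex; eexists; exact: rc.
apply: nearW => m.
apply: le_trans (double_integral_liminf _ _ _ (riesz_trunc_ge0 m)
  (riesz_trunc_le m) (riesz_trunc_lip m) _ _ cmu) _.
apply: le_limn_einf; apply: nearW => k.
apply: energy_ge_double_integral (riesz_trunc_ge0 m) (riesz_trunc_le m)
  (riesz_trunc_lip m) _ => x y.
by rewrite (le_trans (riesz_trunc_rieszk m x y))// leeDr// lee_fin powR_ge0.
Qed.

End RieszPotential.

(** * Divergence of the energies when the limit has support of diameter above 1 *)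

Section Support.
Context {R : realType} {n : nat}.
Implicit Types (mu : Prob R n) (x y : 'rV[R]_n).

(** The set where [f] exceeds half its value at [x] is an open neighbourhood of [x], hence has
    positive mass, and Chebyshev's bound applies on it. *)
Lemma integral_gt0_msupp mu (f : 'rV[R]_n -> R) x :
  continuous f -> (forall y, 0 <= f y) -> 0 < f x -> msupp mu x ->
  (0 < \int[mu]_y (f y)%:E)%E.
Proof.
move=> cf f0 fx sx.
pose U := f @^-1` `]f x / 2, +oo[.
have oU : open U by move/continuousP : cf; apply; exact: interval_open.
have Ux : U x by rewrite /U /= in_itv/= andbT; lra.
have mU : measurable (U : set (borelRn R n)) by exact: sub_gen_smallest.
apply: (@lt_le_trans _ _ (\int[mu]_(y in (U : set (borelRn R n))) (cst (f x / 2)%:E y))%E).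
  rewrite integral_cst//; apply: mule_gt0; first by rewrite lte_fin; lra.
  exact: sx.
rewrite integral_mkcond; apply: le_integral_nonmeasurable => y.
  by apply: erestrict_ge0 => z _; rewrite lee_fin; lra.
rewrite patchE; case: ifPn => [|_]; last by rewrite lee_fin.
by rewrite inE /U /= in_itv/= andbT lee_fin => /ltW.
Qed.

(** This is 1 - 1 / max(r, 1), zero for r <= 1 and positive beyond; writing it with [trunc_pow] lets
    it inherit the Lipschitz bound. *)
Definition excess (r : R) : R := 1 - trunc_pow 1 1 r.

Lemma excess_ge0 r : 0 <= excess r.
Proof.
rewrite subr_ge0 (le_trans (trunc_pow_le _ _ _ _ _))// powRN powR1 invr1.
by [].
Qed.

Lemma excess_le1 r : excess r <= 1.
Proof. by rewrite gerBl trunc_pow_ge0. Qed.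

Lemma excess_lip r s : `|excess r - excess s| <= `|r - s|.
Proof.
have := trunc_pow_lip 1 1 s r ler01 ltr01.
rewrite powR1 mulr1 divr1 mul1r (distrC s) => h.
by have -> : excess r - excess s = trunc_pow 1 1 s - trunc_pow 1 1 r
  by rewrite /excess; ring.
Qed.

Lemma excessE r : 1 <= r -> excess r = 1 - r^-1.
Proof.
by move=> r1; rewrite /excess /trunc_pow max_l// powR_inv1// (le_trans ler01).
Qed.

Lemma excess_gt0 r : 1 < r -> 0 < excess r.
Proof.
move=> r1; rewrite (excessE _ (ltW r1)) subr_gt0 invf_lt1//.
exact: lt_trans r1.
Qed.

(** For r > 1 the chain is a (1 - 1/r) <= a ln r <= exp (a ln r), the first step being ln t <= t - 1
    at t = 1/r. *)
Lemma excess_powR (a r : R) : 0 < a -> a * excess r <= r `^ a.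
Proof.
move=> a0; have [r1|r1] := leP r 1.
  rewrite /excess /trunc_pow max_r// powR1 subrr mulr0; exact: powR_ge0.
have r0 : 0 < r by exact: lt_trans r1.
have lnr : 1 - r^-1 <= ln r.
  have : ln (1 + (r^-1 - 1)) <= r^-1 - 1.
    by apply: le_ln1Dx; rewrite ltrBrDr addNr invr_gt0.
  by rewrite addrC subrK lnV ?posrE//; lra.
rewrite (excessE _ (ltW r1)) /powR (gt_eqF r0).
apply: (@le_trans _ _ (a * ln r)); first by rewrite ler_wpM2l// ltW.
by apply: le_trans (expR_ge1Dx _); rewrite lerDr.
Qed.

(** Two support points at distance above 1 make the double integral [c] of [excess] positive, and
    the lower limit is at least A c for every A > 0. *)
Lemma excess_liminf (lam : R) (alpha_ : nat -> R) (mu_ : nat -> Prob R n) mu :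
  alpha_ @ \oo --> +oo -> mu_ @ \oo --> mu -> ~~ (ediam (msupp mu) <= 1)%E ->
  limn_einf (fun k => energy (alpha_ k) lam (mu_ k)) = +oo%E.
Proof.
move=> aoo cmu; rewrite -ltNge => /ereal_sup_gt[_ [x sx [y sy <-]] xy].
rewrite lte_fin in xy.
have exL r s : `|excess r - excess s| <= 1 * `|r - s| by rewrite mul1r excess_lip.
pose c := (\int[mu]_y (pot excess mu y)%:E)%E.
have pc := pot_continuous _ _ _ excess_ge0 excess_le1 exL mu.
have c0 : (0 < c)%E.
  (* Positivity is used twice: the potential is positive at [y] because [x] is in the support, and
     then its integral is positive because [y] is. *)
  apply: (integral_gt0_msupp _ _ y) => // [z|].
    by apply: pot_ge0; exact: excess_ge0.
  rewrite -lte_fin -(potE _ _ _ excess_ge0 excess_le1 exL).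
  apply: (integral_gt0_msupp _ _ x) => //.
  - exact: kernel_continuous exL y.
  - by move=> z; exact: excess_ge0.
  - exact: excess_gt0.
have step A : 0 < A -> (A%:E * c <= limn_einf (fun k => energy (alpha_ k) lam (mu_ k)))%E.
  move=> A0; pose F r := A * excess r.
  have F0 r : 0 <= F r by rewrite mulr_ge0 ?excess_ge0// ltW.
  have FA r : F r <= A by rewrite -[leRHS]mulr1 ler_wpM2l ?excess_le1// ltW.
  have FL r s : `|F r - F s| <= A * `|r - s|.
    rewrite -mulrBr normrM (gtr0_norm A0) ler_wpM2l ?excess_lip//; exact: ltW.
  have -> : (A%:E * c = \int[mu]_y (pot F mu y)%:E)%E.
    rewrite /c -ge0_integralZl_EFin//; last 3 first.
    - by move=> z _; rewrite lee_fin; apply: pot_ge0; exact: excess_ge0.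
    - by apply/measurable_EFinP; exact: continuous_borel_measurable.
    - exact: ltW.
    apply: eq_integral => z _.
    rewrite -(potE _ _ _ excess_ge0 excess_le1 exL) -(potE _ _ _ F0 FA FL).
    rewrite -ge0_integralZl_EFin//.
    - by move=> u _; rewrite lee_fin excess_ge0.
    - apply/measurable_EFinP; apply: continuous_borel_measurable.
      exact: kernel_continuous exL z.
    - exact: ltW.
  apply: le_trans (double_integral_liminf _ _ _ F0 FA FL _ _ cmu) _.
  apply: le_limn_einf; near=> k.
  apply: energy_ge_double_integral F0 FA FL _ => u v.
  rewrite -[leLHS]adde0 leeD ?rieszk_ge0// lee_fin.
  have Aa : A <= alpha_ k by near: k; move/cvgryPge : aoo; apply.
  apply: le_trans (excess_powR _ _ (lt_le_trans A0 Aa)).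
  by rewrite ler_wpM2r// excess_ge0.
apply/eqyP => A A0.
(* Finiteness of [c] allows the choice A / c, which turns the bound A c into an arbitrary level. *)
have cfin : c \is a fin_num.
  apply: integrable_fin_num => //; apply: continuous_bounded_integrable => //.
  by apply: (bounded_fun_norm _ 1) => z;
    rewrite ger0_norm ?(pot_ge0 _ excess_ge0)//
      (pot_le _ _ _ excess_ge0 excess_le1 exL).
have fc0 : 0 < fine c by rewrite fine_gt0// c0 ltey_eq cfin.
apply: le_trans (step (A / fine c) _); last by rewrite divr_gt0.
by rewrite -(fineK cfin) -EFinM lee_fin/= divfK// gt_eqF.
Unshelve. all: by end_near. Qed.

End Support.

(** * A measure gives no mass to the complement of its support *)

Section SupportFull.
Context {R : realType} {n : nat}.
Implicit Types (mu : Prob R n) (x y : 'rV[R]_n).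

Lemma msuppC_open mu : open (~` msupp mu).
Proof.
rewrite openE => x /existsNP[U /not_implyP[oU /not_implyP[Ux muU]]].
by apply: filterS (open_nbhs_nbhs (conj oU Ux)) => y Uy /(_ U oU Uy).
Qed.

Let qball (p : 'rV[rat]_n * nat) : set 'rV[R]_n :=
  ball (map_mx ratr p.1 : 'rV[R]_n) p.2.+1%:R^-1.

(** Second countability: every point outside the support lies in a null ball with rational centre
    and radius 1 / (m + 1), and there are countably many such balls. *)
Lemma msuppC_null mu : mu (~` msupp mu) = 0%E.
Proof.
have mO (U : set 'rV[R]_n) : open U -> measurable (U : set (borelRn R n)).
  exact: sub_gen_smallest.
have mS : measurable (~` msupp mu : set (borelRn R n)) by apply: mO; exact: msuppC_open.
apply: (measure_negligible mS).
(* The null rational balls are enumerated by their codes; a number that codes no ball, or a ball of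
   positive mass, contributes the empty set. *)
pose V k : set (borelRn R n) := if unpickle k is Some p then
  (if mu (qball p) == 0%E then qball p else set0) else set0.
have Vneg k : mu.-negligible (V k).
  rewrite /V; case: unpickle => [p|]; last exact: negligible_set0.
  case: ifPn => [/eqP p0|_]; last exact: negligible_set0.
  apply/negligibleP => //; apply: mO; exact: ball_open.
apply: negligibleS (negligible_bigcup Vneg).
move=> x /existsNP[U /not_implyP[oU /not_implyP[Ux muU]]].
have muU0 : mu U = 0%E.
  by apply/eqP; rewrite eq_le measure_ge0 andbT leNgt; exact/negP.
have /nbhs_ballP[e /= e0 xeU] : nbhs x U by exact: open_nbhs_nbhs.
have e20 : 0 < e / 2 by rewrite divr_gt0.
have [m me] : exists m : nat, m.+1%:R^-1 < e / 2.
  have [m _ h] := near_infty_natSinv_lt (PosNum e20).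
  by exists m; apply: h => /=.
have m0 : 0 < m.+1%:R^-1 :> R by rewrite invr_gt0.
(* Balls are those of the sup norm, so a rational centre can be chosen coordinate by coordinate. As
   2 / (m + 1) < e, the ball around it stays within distance [e] of [x]. *)
have Q i : exists q : rat, `|ratr q - x ord0 i| < m.+1%:R^-1.
  have /rat_in_itvoo[q /itvP qx] : x ord0 i - m.+1%:R^-1 < x ord0 i + m.+1%:R^-1.
    by rewrite ltrBlDr -addrA ltrDl addr_gt0.
  by exists q; rewrite ltr_distl !qx.
have {Q} [q Q] := choice Q.
pose p : 'rV[rat]_n * nat := (\row_i q i, m).
have px : qball p x.
  split => //= i j; rewrite !mxE (ord1 i); exact: Q.
exists (pickle p) => //; rewrite /V pickleK; case: ifPn => [//|/eqP []].
apply: (subset_measure0 _ _ _ muU0); [by apply: mO; exact: ball_open|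
  exact: mO|].
move=> y py; apply: xeU.
apply: (@le_ball _ _ _ (m.+1%:R^-1 + m.+1%:R^-1)).
  by rewrite (splitr e); apply: lerD; exact: ltW.
apply: ball_triangle py; exact: ball_sym.
Qed.

Lemma edist_le1_msupp mu x y : (ediam (msupp mu) <= 1)%E ->
  msupp mu x -> msupp mu y -> edist x y <= 1.
Proof.
move=> d1 sx sy; rewrite -lee_fin; apply: le_trans d1.
by apply: ereal_sup_ubound; exists x => //; exists y.
Qed.

End SupportFull.

(** * Dilations of a measure and their energies *)

Section Dilation.
Context {R : realType} {n : nat}.
Implicit Types (mu : Prob R n) (x y : 'rV[R]_n) (s : R).

Definition scalerv s : borelRn R n -> borelRn R n := fun x => s *: (x : 'rV[R]_n).

Lemma scalerv_measurable s : measurable_fun setT (scalerv s).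
Proof.
apply: (measurability _ (erefl (@measurable _ (borelRn R n)))).
move=> _ [U oU <-]; rewrite setTI; apply: sub_gen_smallest.
by have /continuousP := @scaler_continuous R 'rV[R]_n s; exact.
Qed.

HB.instance Definition _ s :=
  isMeasurableFun.Build _ _ _ _ (scalerv s) (scalerv_measurable s).

Definition dilate s mu : Prob R n :=
  (distribution (mu : probability (borelRn R n) R) (scalerv s)
    : probability (borelRn R n) R).

Lemma ge0_integral_dilate s mu (f : borelRn R n -> \bar R) :
  measurable_fun setT f -> (forall x, (0 <= f x)%E) ->
  (\int[dilate s mu]_x f x = \int[mu]_x f (s *: (x : 'rV[R]_n)))%E.
Proof. by move=> mf f0; rewrite ge0_integral_distribution. Qed.

(** After a change of variables the integrands phi (s_k x) converge pointwise to phi x, and a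
    constant dominates them. *)
Lemma dilate_cvg (s_ : nat -> R) mu :
  s_ @ \oo --> (1 : R) -> (fun k => dilate (s_ k) mu) @ \oo --> mu.
Proof.
move=> s1; apply/weak_cvgP => phi cphi [M [_ phiM]].
(* [bounded_fun] only provides bounds strictly larger than [M], and |M| + 1 is such a bound. *)
have {}phiM x : `|phi x| <= `|M| + 1.
  by apply: phiM => //; rewrite (le_lt_trans (ler_norm M))// ltrDl.
have mphi : measurable_fun setT (phi : borelRn R n -> R).
  exact: continuous_borel_measurable.
have cphis s : continuous (fun x : 'rV[R]_n => phi (s *: x)).
  by move=> x; apply: continuous_comp; [exact: scaler_continuous|exact: cphi].
have intM (f : 'rV[R]_n -> R) : continuous f -> (forall x, `|f x| <= `|M| + 1) ->
    mu.-integrable setT (EFin \o f).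
  move=> cf fM; apply: continuous_bounded_integrable => //.
  exact: bounded_fun_norm fM.
have dE k : (\int[dilate (s_ k) mu]_x (phi x)%:E =
    \int[mu]_x (phi (s_ k *: (x : 'rV[R]_n)))%:E)%E.
  rewrite integral_distribution//; first exact/measurable_EFinP.
  exact: (intM (fun x => phi (s_ k *: x))).
rewrite /Rintegral; apply: fine_cvg; rewrite fineK; last first.
  by apply: integrable_fin_num => //; exact: intM.
under eq_fun do rewrite dE.
have [| | | | |_ _ H] := @dominated_convergence _ _ _ mu setT measurableT
  (fun k x => (phi (s_ k *: (x : 'rV[R]_n)))%:E) (fun x => (phi x)%:E)
  (fun=> (`|M| + 1)%:E).
- by move=> k; apply/measurable_EFinP; exact: continuous_borel_measurable.
- exact/measurable_EFinP.
- apply: aeW => x _; apply: cvg_EFin; first exact: nearW.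
  have sx : s_ k *: (x : 'rV[R]_n) @[k --> \oo] --> (x : 'rV[R]_n).
    by rewrite -[X in _ --> X](scale1r (x : 'rV[R]_n)); exact: (cvgZr_tmp s1).
  exact: cvg_comp sx (cphi x).
- apply: (intM (fun=> `|M| + 1)); first exact: cst_continuous.
  by move=> _; rewrite ger0_norm// addr_ge0.
- by apply: aeW => x k _; rewrite abse_EFin lee_fin.
- exact: H.
Qed.

Lemma rieszk_scale (lam s : R) x y : 0 < s ->
  rieszk lam (s *: x) (s *: y) = ((s `^ (- lam))%:E * rieszk lam x y)%E.
Proof.
move=> s0; rewrite /rieszk (inj_eq (scalerI (lt0r_neq0 s0))).
case: ifPn => _; first by rewrite gt0_muley// lte_fin powR_gt0.
by rewrite (edist_scale _ _ _ (ltW s0)) powRM ?edist_ge0 ?ltW.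
Qed.

(** Change of variables in both integrals, combined with the homogeneity of degree -lam of the
    kernel. *)
Lemma riesz_energy_dilate (lam s : R) mu : 0 < lam -> 0 < s ->
  (\int[dilate s mu]_y \int[dilate s mu]_x rieszk lam x y =
   (s `^ (- lam))%:E * \int[mu]_y \int[mu]_x rieszk lam x y)%E.
Proof.
move=> lam0 s0.
rewrite ge0_integral_dilate; last 2 first.
- exact: riesz_potential_measurable.
- by move=> y; apply: integral_ge0 => x _; exact: rieszk_ge0.
rewrite -ge0_integralZl_EFin//; last 3 first.
- by move=> y _; apply: integral_ge0 => x _; exact: rieszk_ge0.
- exact: riesz_potential_measurable.
- exact: powR_ge0.
apply: eq_integral => y _.
rewrite ge0_integral_dilate; last 2 first.
- exact: rieszk_measurable.
- by move=> x; exact: rieszk_ge0.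
rewrite -ge0_integralZl_EFin//; last 3 first.
- by move=> x _; exact: rieszk_ge0.
- exact: rieszk_measurable.
- exact: powR_ge0.
by apply: eq_integral => x _; rewrite rieszk_scale.
Qed.

(** Almost all points of the dilated measure lie in the dilated support, where distances are at most
    [s]; the attractive term is then at most s^alpha, integrated against total mass 1. *)
Lemma energy_dilate (alpha lam s : R) mu : 0 < alpha -> 0 < lam -> 0 < s ->
  (ediam (msupp mu) <= 1)%E ->
  (energy alpha lam (dilate s mu) <=
   (s `^ alpha)%:E + (s `^ (- lam))%:E * \int[mu]_y \int[mu]_x rieszk lam x y)%E.
Proof.
move=> a0 lam0 s0 d1; set nu := dilate s mu.
(* The complement of the dilated support, written as a preimage so that its measurability is
   immediate; pulled back by the dilation it becomes the null complement of [msupp mu]. *)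
pose N : set (borelRn R n) := scalerv s^-1 @^-1` (~` msupp mu).
have mN : measurable N.
  rewrite -[N]setTI; apply: scalerv_measurable => //.
  by apply: sub_gen_smallest; exact: msuppC_open.
have N0 : nu N = 0%E.
  rewrite -(msuppC_null mu); congr (mu _); apply/seteqP.
  by split => x; rewrite /N /= /scalerv scalerA mulVf ?gt_eqF// scale1r.
have in_supp x : ~ N x -> exists2 x', x = s *: x' & msupp mu x'.
  move=> /contrapT sx; exists (s^-1 *: x) => //.
  by rewrite scalerA mulfV ?gt_eqF// scale1r.
have dist_le x y : ~ N x -> ~ N y -> edist x y <= s.
  move=> /in_supp[x' -> sx] /in_supp[y' -> sy]; rewrite (edist_scale _ _ _ (ltW s0)).
  by rewrite -[leRHS]mulr1 ler_wpM2l ?(ltW s0)// (edist_le1_msupp mu).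
have Kge0 x y := rieszk_ge0 lam x y.
have Ige0 y : (0 <= \int[nu]_x rieszk lam x y)%E by apply: integral_ge0.
have sa0 : (0 <= (s `^ alpha)%:E)%E by rewrite lee_fin powR_ge0.
rewrite -riesz_energy_dilate// -/nu -[(s `^ alpha)%:E](integral_cst_Prob nu).
rewrite -ge0_integralD//; last exact: riesz_potential_measurable.
(* The null set is discarded first in the outer variable, then again in the inner one. *)
apply: (le_integral_off_null _ N) => //.
- by apply: emeasurable_funD; [exact: measurable_cst|exact: riesz_potential_measurable].
- move=> y; apply: integral_ge0 => x _; rewrite adde_ge0// lee_fin powR_ge0//.
- by move=> y; rewrite adde_ge0.
move=> y Ny.
rewrite -[X in (_ <= X + _)%E](integral_cst_Prob nu) -ge0_integralD//; last first.
  exact: rieszk_measurable.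
apply: (le_integral_off_null _ N) => //.
- by apply: emeasurable_funD; [exact: measurable_cst|exact: rieszk_measurable].
- by move=> x; rewrite adde_ge0// lee_fin powR_ge0.
- by move=> x; rewrite adde_ge0.
move=> x Nx; rewrite leeD2r// lee_fin.
by apply: ge0_ler_powR; rewrite ?nnegrE ?edist_ge0 ?(ltW s0) ?(ltW a0) ?dist_le.
Qed.

End Dilation.

Lemma le_limn_esup {R : realType} (a b : (\bar R)^nat) :
  (\forall k \near \oo, (a k <= b k)%E) -> (limn_esup a <= limn_esup b)%E.
Proof.
move=> ab; rewrite -[leLHS]oppeK -[leRHS]oppeK -!limn_einfN leeN2.
by apply: le_limn_einf; apply: filterS ab => k /=; rewrite leeN2.
Qed.

(** * The recovery sequence *)

Section Recovery.
Context {R : realType} {n : nat}.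
Variables (lam : R) (alpha_ : nat -> R).
Hypotheses (lam0 : 0 < lam) (alpha0 : forall k, 0 < alpha_ k).
Hypothesis alphaoo : alpha_ @ \oo --> +oo.
Implicit Type mu : Prob R n.

(** Both [q k] and alpha_k / q_k must tend to infinity; with the square root the two coincide. *)
Let q k : R := Num.sqrt (alpha_ k).

Let q_gt0 k : 0 < q k. Proof. by rewrite sqrtr_gt0. Qed.

Let q_cvgy : q @ \oo --> +oo.
Proof.
apply/cvgryPge => A; near=> k; rewrite (le_trans (ler_norm A))// -sqrtr_sqr.
by rewrite ler_wsqrtr//; near: k; move/cvgryPge : alphaoo; apply.
Unshelve. all: by end_near. Qed.

Let qV_cvg0 : (q k)^-1 @[k --> \oo] --> (0 : R).
Proof. by apply/gtr0_cvgV0 => //; exact: nearW. Qed.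

(* [ratio k] tends to 1 slowly enough that [ratio k `^ alpha_ k] still tends
   to 0. *)
Definition ratio k : R := expR (- (q k)^-1).

Lemma ratio_gt0 k : 0 < ratio k.
Proof. exact: expR_gt0. Qed.

Let expR_cvg1 (c : R) : expR (c * (q k)^-1) @[k --> \oo] --> (1 : R).
Proof.
rewrite -(@expR0 R); apply: continuous_cvg; first exact: continuous_expR.
by rewrite -(mulr0 c); exact: cvgMl_tmp.
Qed.

Lemma ratio_cvg1 : ratio @ \oo --> (1 : R).
Proof.
have -> : ratio = fun k => expR (-1 * (q k)^-1).
  by apply/funext => k; rewrite mulN1r.
exact: expR_cvg1.
Qed.

Lemma ratio_powRN_cvg1 : ratio k `^ (- lam) @[k --> \oo] --> (1 : R).
Proof.
under eq_fun do rewrite /powR gt_eqF ?ratio_gt0// /ratio expRK mulrNN.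
exact: expR_cvg1.
Qed.

Lemma ratio_powR_cvg0 : ratio k `^ alpha_ k @[k --> \oo] --> (0 : R).
Proof.
have E k : ratio k `^ alpha_ k = expR (- q k).
  rewrite /powR gt_eqF ?ratio_gt0// /ratio expRK mulrN; congr (expR (- _)).
  have -> : alpha_ k = q k * q k by rewrite -expr2 sqr_sqrtr// ltW.
  by rewrite mulfK// gt_eqF.
under eq_fun do rewrite E.
exact: (cvg_comp _ _ q_cvgy (@cvgr_expR R)).
Qed.

(** A constant sequence serves whenever the limit energy is infinite, be it from the diameter or
    from the Riesz energy. Otherwise the dilations by [ratio k] are used. *)
Lemma recovery_limsup mu :
  exists2 mu_ : nat -> Prob R n, mu_ @ \oo --> mu &
    (limn_esup (fun k => energy (alpha_ k) lam (mu_ k)) <= energy_lim lam mu)%E.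
Proof.
have trivial_case : energy_lim lam mu = +oo%E -> exists2 mu_ : nat -> Prob R n,
    mu_ @ \oo --> mu &
    (limn_esup (fun k => energy (alpha_ k) lam (mu_ k)) <= energy_lim lam mu)%E.
  move=> ->; exists (fun=> mu); last exact: leey.
  exact: (@cvg_cst (Prob R n)).
have [d1|d1] := boolP (ediam (msupp mu) <= 1)%E; last first.
  by apply: trivial_case; rewrite /energy_lim (negbTE d1).
have E : energy_lim lam mu = (\int[mu]_y \int[mu]_x rieszk lam x y)%E.
  by rewrite /energy_lim d1.
have I0 : (0 <= energy_lim lam mu)%E.
  by rewrite E; apply: integral_ge0 => y _; apply: integral_ge0 => x _; exact: rieszk_ge0.
have [Ioo|Ioo] := eqVneq (energy_lim lam mu) +oo%E; first exact: trivial_case.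
exists (fun k => dilate (ratio k) mu); first exact: dilate_cvg ratio_cvg1.
pose c := fine (energy_lim lam mu).
have Ic : energy_lim lam mu = c%:E.
  by rewrite fineK// ge0_fin_numE// ltey.
(* The bound of [energy_dilate] as a real sequence, which is possible because [c] is finite; its
   limit is 0 + 1 * c. *)
pose b k := ratio k `^ alpha_ k + ratio k `^ (- lam) * c.
have bc : (b k)%:E @[k --> \oo] --> c%:E.
  apply: cvg_EFin; first exact: nearW.
  rewrite -[X in _ --> X]add0r -[X in _ --> 0 + X]mul1r.
  apply: cvgD; first exact: ratio_powR_cvg0.
  by apply: cvgMr_tmp; exact: ratio_powRN_cvg1.
rewrite Ic -(cvg_limn_einf_sup bc).2; apply: le_limn_esup; apply: nearW => k.
by rewrite /b EFinD EFinM -Ic E energy_dilate// ratio_gt0.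
Qed.

End Recovery.

Theorem theorem1 (R : realType) (n : nat) (lam : R) (alpha_ : nat -> R) :
  (1 <= n)%N -> 0 < lam < n%:R ->
  (forall k, 0 < alpha_ k) -> alpha_ @ \oo --> +oo ->
  @gamma_cvg R (Prob R n) (fun k => energy (alpha_ k) lam) (energy_lim lam).
Proof.
move=> _ /andP[lam0 _] alpha0 alphaoo mu; split; last exact: recovery_limsup.
(* The diameter of the support of the limit measure decides between the two lower bounds. *)
move=> mu_ cmu; rewrite /energy_lim; case: ifPn => d1; first exact: riesz_liminf.
by rewrite (excess_liminf _ _ _ mu).
Qed.
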